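(* Let $\lambda\in(-1,1)$ and let $n\ge1$ be an integer. There is a unique $\sigma\in D_n$ such that $\langle p,\sigma-\lambda\rangle=0$ for every real polynomial $p$ of degree at most $n-1$, namely $\sigma=\Sigma_n(\mathbf x)$, where $x_1,\dots,x_n$ are the roots, listed in increasing order, of the following two polynomials in $x$ taken together: $P_m(x,\theta)$ and $P_m(x,-\theta)$ with $\theta=\frac{1-\lambda}{2}$ if $n=2m$; $Q_{m+1}(x,\theta)$ and $R_m(x,-\theta)$ with $\theta=\frac{1+\lambda}{2}$ if $n=2m+1$.
   Context: For $f\in L^1[0,1]$ and $g\in L^\infty[0,1]$, $\langle f,g\rangle=\int_0^1 g(t)f(t)\,dt$. Let $\Delta^n=\{\mathbf x\in\mathbb R^n\mid 0\le x_1\le x_2\le\dots\le x_n\le 1\}$, and put $x_0=0$, $x_{n+1}=1$. For $\mathbf x\in\Delta^n$, $\Sigma_n(\mathbf x)\in L^\infty[0,1]$ is the class of the function with $\Sigma_n(\mathbf x)(t)=(-1)^m$ for $x_m\le t<x_{m+1}$ ($0\le m\le n$) and $\Sigma_n(\mathbf x)(1)=(-1)^n$. Let $D_n=\Sigma_n(\Delta^n)\subset L^\infty[0,1]$ (elements of $L^\infty$ are identified when equal almost everywhere). With generalized binomial coefficients $\binom{t}{i}=t(t-1)\cdots(t-i+1)/i!$, for integers $m\ge0$ define $$P_m(x,\theta)=\sum_{i=0}^m(-1)^i\frac{m!\,(2m-i)!}{(2m)!\,(m-i)!}\binom{m+\theta}{i}x^{m-i},$$ $$Q_{m+1}(x,\theta)=\sum_{i=0}^{m+1}(-1)^i\frac{(m+1)!\,(2m+1-i)!}{(2m+1)!\,(m+1-i)!}\binom{m+\theta}{i}x^{m+1-i},$$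 $$R_m(x,\theta)=\sum_{i=0}^m(-1)^i\frac{m!\,(2m+1-i)!}{(2m+1)!\,(m-i)!}\binom{m+1+\theta}{i}x^{m-i}.$$ *)

(* Defs.v *)
From HB Require Import structures.
From mathcomp Require Import all_boot all_order all_algebra.
From mathcomp Require Import all_classical all_reals all_analysis.
From mathcomp Require Import measurable_realfun ess_sup_inf.

Set Implicit Arguments.
Unset Strict Implicit.
Unset Printing Implicit Defensive.
Import Order.TTheory GRing.Theory Num.Theory.
Import numFieldNormedType.Exports.

Local Open Scope classical_set_scope.
Local Open Scope ring_scope.

Section Linfty.
Variable R : realType.

Lemma measurable_itv01 : measurable (`[0, 1] : set (measurableTypeR R)).
Proof. exact: measurable_itv. Qed.

(* Lebesgue measure on [0, 1], seen as a measure on the line that vanishes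
   outside [0, 1]: elements of Linfty are functions on R, and equality
   mu01-almost everywhere ignores their values outside [0, 1] *)
Definition mu01 : {measure set (measurableTypeR R) -> \bar R} :=
  mrestr lebesgue_measure measurable_itv01.

Lemma ley_refl : (1 <= +oo :> \bar R)%E.
Proof. exact: leey. Qed.

Definition Linfty : Type := LspaceType mu01 ley_refl.

Lemma eq_Linfty (f g : Linfty) : f = g %[ae mu01] -> f = g.
Proof.
case: f g => [f [[hf]]] [g [[hg]]] /= fg.
have {}fg : f = g.
  by move/ae_eqP/eqP: fg; rewrite !reprK.
by case: _ / fg hg => hg; rewrite (Prop_irrelevance hf hg).
Qed.

Definition pairing (f g : R -> R) : R :=
  \int[lebesgue_measure]_(t in `[0, 1]) (g t * f t).

End Linfty.

Section Sigma.
Variables (R : realType) (n : nat).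
Implicit Types x : n.-tuple R.

Definition Delta : set (n.-tuple R) :=
  [set x | sorted <=%R (0 :: rcons x 1)].

(* x_0 = 0, x_1, ..., x_n, x_(n+1) = 1 *)
Definition node x (m : nat) : R := nth 1 (0 :: rcons x 1) m.

(* for x in Delta, at most one term is nonzero at each t; the last one sets
   the value at t = 1 *)
Definition Sigma_fun x (t : measurableTypeR R) : R :=
  \sum_(m < n.+1) (-1) ^+ m * \1_(`[node x m, node x m.+1[ : set R) t
  + (-1) ^+ n * \1_([set 1] : set R) t.

Lemma Sigma_fun_itv x (m : nat) (t : R) : Delta x -> (m <= n)%N ->
  node x m <= t < node x m.+1 -> Sigma_fun x t = (-1) ^+ m.
Proof.
rewrite /Delta [X in X -> _]/mkset => Dx mn /andP[xt tx].
have sz : size (0 :: rcons x 1) = n.+2 by rewrite /= size_rcons size_tuple.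
have mono i j : (i <= j)%N -> (j < n.+2)%N -> node x i <= node x j.
  move=> ij jn.
  by apply: (sorted_leq_nth le_trans (@lexx _ R) 1 Dx) => //;
    
    rewrite inE sz // (leq_ltn_trans ij).
have x1 : node x n.+1 = 1 by rewrite /node /= nth_rcons size_tuple ltnn eqxx.
have t1 : t < 1 by rewrite -x1; apply: lt_le_trans tx _; apply: mono.
rewrite /Sigma_fun [X in _ * X](_ : _ = 0) ?mulr0 ?addr0; last first.
  by rewrite indicE memNset //= => tE; rewrite tE ltxx in t1.
have mn1 : (m < n.+1)%N by [].
rewrite (bigD1 (Ordinal mn1)) //= indicE mem_set ?mulr1; last first.
  by rewrite /= in_itv /= xt.
rewrite big1 ?addr0 // => i im.
rewrite indicE memNset ?mulr0 //= in_itv /= => /andP[xi ix].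
have := im; rewrite -val_eqE /= neq_ltn => /orP[lim|lmi].
  have : node x i.+1 <= node x m by apply: mono => //; rewrite ltnS ltnW.
  by move=> /(lt_le_trans ix)/lt_le_trans/(_ xt); rewrite ltxx.
have : node x m.+1 <= node x i by apply: mono => //; rewrite ltnW // ltnS.
by move=> /(lt_le_trans tx)/lt_le_trans/(_ xi); rewrite ltxx.
Qed.

Lemma Sigma_fun1 x : Delta x -> Sigma_fun x 1 = (-1) ^+ n.
Proof.
rewrite /Delta [X in X -> _]/mkset => Dx.
have sz : size (0 :: rcons x 1) = n.+2 by rewrite /= size_rcons size_tuple.
rewrite /Sigma_fun [X in _ * X](_ : _ = 1) ?mulr1; last first.
  by rewrite indicE mem_set.
rewrite big1 ?add0r // => i _.
rewrite indicE memNset ?mulr0 //= in_itv /= => /andP[_].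
have x1 : node x n.+1 = 1 by rewrite /node /= nth_rcons size_tuple ltnn eqxx.
have : node x i.+1 <= node x n.+1.
  by apply: (sorted_leq_nth le_trans (@lexx _ R) 1 Dx) => //;
     rewrite inE sz // ltnS.
by rewrite x1 => /lt_le_trans/[apply]; rewrite ltxx.
Qed.

Lemma measurable_Sigma_fun x :
  measurable_fun [set: measurableTypeR R] (Sigma_fun x).
Proof.
apply: measurable_funD; last first.
  by apply: measurable_funM => //; apply: measurable_indic; exact: measurable_set1.
by apply: measurable_sum => m; exact: measurable_funM.
Qed.

Definition Sigma_mfun x : {mfun measurableTypeR R >-> measurableTypeR R} :=
  HB.pack (Sigma_fun x)
    (isMeasurableFun.Build _ _ (measurableTypeR R) (measurableTypeR R)
      (Sigma_fun x) (measurable_Sigma_fun x)).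

Lemma Sigma_fun_bounded x t : `|Sigma_fun x t| <= n.+2%:R.
Proof.
have le1 (i : nat) (A : set R) : `|(-1) ^+ i * \1_A t| <= 1 :> R.
  by rewrite normrM normrX normrN1 expr1n mul1r indicE; case: (_ \in _);
    rewrite ?normr1 ?normr0.
rewrite -[n.+2]addn1 natrD; apply: le_trans (ler_normD _ _) _.
apply: lerD => //; apply: le_trans (ler_norm_sum _ _ _) _.
apply: le_trans (ler_sum _ (fun i _ => le1 _ _)) _.
by rewrite sumr_const card_ord.
Qed.

Local Open Scope quotient_scope.

Definition Sigma_class x :
    {mfun_ (mu01 R), measurableTypeR R >-> measurableTypeR R} :=
  \pi_({mfun_ (mu01 R), measurableTypeR R >-> measurableTypeR R}) (Sigma_mfun x).

Lemma Sigma_classE x : Sigma_class x = Sigma_fun x %[ae (mu01 R)].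
Proof.
by have /eqP := reprK (Sigma_class x); rewrite eqmodE => /asboolP.
Qed.

Lemma finite_norm_Sigma x : finite_norm (mu01 R) +oo%E (Sigma_class x).
Proof.
rewrite /finite_norm unlock; case: ifPn => // _.
apply: (@le_lt_trans _ _ (n.+2%:R)%:E); last exact: ltry.
apply/ess_supP; apply: filterS (Sigma_classE x) => t /(_ I) /= ->.
by rewrite lee_fin Sigma_fun_bounded.
Qed.

Definition Sigma x : Linfty R :=
  HB.pack (Sigma_class x)
    (isFinLebesgue.Build _ _ _ (mu01 R) +oo%E (ley_refl R) (Sigma_class x)
      (finite_norm_Sigma x)).

Lemma SigmaE x : Sigma x = Sigma_fun x %[ae (mu01 R)].
Proof. exact: Sigma_classE. Qed.

Definition D : set (Linfty R) := [set Sigma x | x in Delta].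

End Sigma.
Arguments D : clear implicits.

Section polynomials.
Variable R : realType.
Implicit Types (t theta : R) (p q : {poly R}).

Definition gbinom t (i : nat) : R := (\prod_(j < i) (t - j%:R)) / i`!%:R.

Definition Ppoly (m : nat) theta : {poly R} :=
  \sum_(i < m.+1)
    ((-1) ^+ i * ((m`! * (2 * m - i)`!)%:R / ((2 * m)`! * (m - i)`!)%:R)
     * gbinom (m%:R + theta) i) *: 'X^(m - i).

(* the polynomial Q_(m+1) *)
Definition Qpoly (m : nat) theta : {poly R} :=
  \sum_(i < m.+2)
    ((-1) ^+ i * (((m.+1)`! * (2 * m + 1 - i)`!)%:R
                  / ((2 * m + 1)`! * (m + 1 - i)`!)%:R)
     * gbinom (m%:R + theta) i) *: 'X^(m + 1 - i).

Definition Rpoly (m : nat) theta : {poly R} :=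
  \sum_(i < m.+1)
    ((-1) ^+ i * ((m`! * (2 * m + 1 - i)`!)%:R
                  / ((2 * m + 1)`! * (m - i)`!)%:R)
     * gbinom (m%:R + 1 + theta) i) *: 'X^(m - i).

(* strict order: s is used with deg p + deg q entries (p, q monic), so s being
   strictly sorted amounts to all the roots of p * q being real and simple, and
   multiplicities need not be recorded *)
Definition lists_roots (s : seq R) p q : Prop :=
  sorted <%R s /\ (forall a, (a \in s) = root p a || root q a).

End polynomials.

(* Main.v *)
Require Import Defs.
From HB Require Import structures.
From mathcomp Require Import all_boot all_order all_algebra.
From mathcomp Require Import all_classical all_reals all_analysis.
From mathcomp Require Import measurable_realfun polyorder polyrcf ring lra zify.
Import Order.TTheory GRing.Theory Num.Theory.
Import numFieldNormedType.Exports.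
Local Open Scope classical_set_scope.
Local Open Scope ring_scope.

(** Integrating by parts on the intervals cut by the nodes turns the
    orthogonality of [Sigma x - lambda] to the polynomials of degree less than
    [n] into conditions on power sums ([orthogonal_Sigma]): with
    [tau = ((-1)^n - lambda) / 2], for [1 <= k <= n],
      [sum of x_j^k over odd j - sum of x_j^k over even j = - tau].
    Put [A = prod ('X - x_j)] over odd [j] and [B] likewise over even [j]. The
    conditions say that the quotient of the reversals of [B] and [A] agrees with
    [(1 - z)^tau] up to order [n]: it is a Pade approximant.

    Uniqueness. If [x] and [y] satisfy the conditions, then the odd nodes of [x]
    together with the even nodes of [y] have the same power sums of orders
    [0..n] as the odd nodes of [y] together with the even nodes of [x]. These
    are lists of length [n], hence permutations of each other
    ([eq_psum_perm]). Since [Sigma x] at [t] depends only on the number of odd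
    nodes not above [t] minus the number of even ones, [Sigma x = Sigma y].

    Existence. The explicit polynomials are monic Jacobi polynomials for
    weights [x^(b-1) (1-x)^(a-1)] with [a, b > 0] ([jacobi_poly_eq]), so that
    all their roots are simple and lie in the open unit interval
    ([jacobi_roots], by induction on the degree: the derivative of a Jacobi
    polynomial is again one, and the differential equation makes the polynomial
    alternate in sign at the critical points and at 0 and 1). The two
    differential equations combine into a first integral
    ([jacobi_wronskian]): with [W = A' B - A B'] and [d = n mod 2],
      [x (1 - x) W = (d (1 - x) + tau) A B + c] for a constant [c].
    At the roots of [A] it forces [B] to alternate, so that the roots
    interlace ([interlacing_nodes]). Expanded at infinity, where
    [W / (A B) = A' / A - B' / B] generates the differences of power sums, it
    gives the required conditions ([psum_of_wronskian]). *)

Set Implicit Arguments.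
Unset Strict Implicit.
Unset Printing Implicit Defensive.

(** * Entries of odd and even rank of a sequence *)

(** Ranks are counted from 1, in accordance with the numbering of the nodes:
    the head of a sequence belongs to [odds]. *)

Fixpoint odds {T : Type} (s : seq T) : seq T :=
  if s is a :: s' then a :: evens s' else [::]
with evens {T : Type} (s : seq T) : seq T :=
  if s is _ :: s' then odds s' else [::].

Lemma size_odds_evens {T : Type} (s : seq T) :
  (size (odds s) = uphalf (size s)) * (size (evens s) = (size s)./2).
Proof. by elim: s => //= a s [-> ->]. Qed.

Lemma odds_evens_rcons {T : Type} (s : seq T) (a : T) :
  odds (rcons s a) = (if odd (size s) then odds s else rcons (odds s) a) /\
  evens (rcons s a) = (if odd (size s) then rcons (evens s) a else evens s).
Proof. by elim: s => //= b s [-> ->]; case: odd. Qed.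

Lemma subseq_odds_evens {T : eqType} (s : seq T) :
  subseq (odds s) s /\ subseq (evens s) s.
Proof.
elim: s => //= a s [so se]; rewrite eqxx; split=> //.
exact: subseq_trans so (subseq_cons _ _).
Qed.

Lemma perm_odds_evens {T : eqType} (s : seq T) : perm_eq s (odds s ++ evens s).
Proof.
elim: s => //= a s; rewrite perm_cons => /perm_trans; apply.
by rewrite perm_catC.
Qed.

Lemma sum_odds_evens {T : Type} {V : pzRingType} (x0 : T) (f : T -> V)
    (s : seq T) :
  \sum_(a <- odds s) f a - \sum_(a <- evens s) f a =
  \sum_(j < size s) (-1) ^+ j * f (nth x0 s j).
Proof.
elim: s => [|a s IH]; first by rewrite !big_nil big_ord0 subrr.
rewrite big_ord_recl /= big_cons expr0 mul1r -addrA; congr (_ + _).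
rewrite -opprB IH -sumrN; apply: eq_bigr => i _.
by rewrite exprS mulN1r mulNr.
Qed.

(** * Polynomials with simple real roots *)

Section RealRoots.
Variable R : rcfType.
Implicit Types (a b : R) (s t : seq R) (p q A B : {poly R}).

Definition prodX s : {poly R} := \prod_(a <- s) ('X - a%:P).

Lemma prodX_cons a s : prodX (a :: s) = ('X - a%:P) * prodX s.
Proof. by rewrite /prodX big_cons. Qed.

Lemma size_prodX s : size (prodX s) = (size s).+1.
Proof. exact: size_prod_XsubC. Qed.

Lemma monic_prodX s : prodX s \is monic.
Proof. exact: monic_prod_XsubC. Qed.

Lemma root_prodX s a : root (prodX s) a = (a \in s).
Proof. exact: root_prod_XsubC. Qed.

Lemma monic_roots_prodX p s : p \is monic -> size p = (size s).+1 ->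
  uniq s -> all (root p) s -> p = prodX s.
Proof.
move=> pm sp us rs; rewrite [LHS](all_roots_prod_XsubC sp rs) ?uniq_rootsE //.
by rewrite (monicP pm) scale1r.
Qed.

Lemma deriv_prodX_cons a s x :
  (prodX (a :: s))^`().[x] = (prodX s).[x] + (x - a) * (prodX s)^`().[x].
Proof. by rewrite prodX_cons derivM derivXsubC mul1r !hornerE. Qed.

Lemma prodX_lt_gt0 s a b : all (> a) s -> all (> b) s ->
  0 < (prodX s).[a] * (prodX s).[b].
Proof.
elim: s => [|c s IH] /=; first by rewrite /prodX big_nil !hornerE.
move=> /andP[ac sa] /andP[bc sb]; rewrite prodX_cons !hornerM !hornerXsubC.
by rewrite mulrACA mulr_gt0 ?IH // nmulr_rgt0 subr_lt0.
Qed.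

Lemma prodX_gt0 s x : all (< x) s -> 0 < (prodX s).[x].
Proof.
elim: s => [|c s IH] /=; first by rewrite /prodX big_nil !hornerE.
by move=> /andP[cx sx]; rewrite prodX_cons !hornerE mulr_gt0 ?subr_gt0 ?IH.
Qed.

Lemma deriv_prodX_neq0 s a : uniq s -> a \in s -> (prodX s)^`().[a] != 0.
Proof.
elim: s => // b s IH /= /andP[bs us].
rewrite inE deriv_prodX_cons; case: eqVneq => [-> _|ab /= sa].
  by rewrite subrr mul0r addr0 -rootE root_prodX.
have /eqP -> : (prodX s).[a] == 0 by rewrite -rootE root_prodX.
by rewrite add0r mulf_neq0 ?subr_eq0 // IH.
Qed.

Definition alternates (g : R -> R) : rel R :=
  fun a b => (a < b) && (g a * g b < 0).

(** The derivative of [prodX s] at a root is the product of the differences with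
    the other roots, one more of which is negative than at the next root. *)
Lemma alternates_deriv_prodX (g : R -> R) s : sorted <%R s ->
  (forall a, a \in s -> 0 < g a * (prodX s)^`().[a]) ->
  sorted (alternates g) s.
Proof.
elim: s => // a s IH; rewrite /= => pas gs.
have sgt : all (> a) s by rewrite lt_path_min.
have gs' x : x \in s -> 0 < g x * (prodX s)^`().[x].
  move=> xs; have := gs x; rewrite inE xs orbT deriv_prodX_cons => /(_ isT).
  have /eqP -> : (prodX s).[x] == 0 by rewrite -rootE root_prodX.
  rewrite add0r mulrCA pmulr_rgt0 // subr_gt0.
  by move/allP: sgt; apply.
move/path_sorted: (pas) => /IH/(_ gs') sas.
case: s pas gs sgt gs' sas {IH} => // b s /= /andP[ab pbs] gs.
move=> /andP[_ sgt] gs' ->; rewrite andbT /alternates ab /=.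
have := gs a; rewrite mem_head => /(_ isT).
rewrite deriv_prodX_cons subrr mul0r addr0 prodX_cons hornerM hornerXsubC.
have := gs' b; rewrite mem_head => /(_ isT).
rewrite deriv_prodX_cons subrr mul0r addr0.
have := prodX_lt_gt0 sgt (order_path_min lt_trans pbs).
move: ((prodX s).[a]) ((prodX s).[b]) => u v uv gv gu.
have : 0 < (g b * v) * (g a * ((a - b) * u)) by rewrite mulr_gt0.
have -> : (g b * v) * (g a * ((a - b) * u)) = (g a * g b) * ((a - b) * (u * v)).
  by ring.
by rewrite nmulr_lgt0 // nmulr_rlt0 // subr_lt0.
Qed.

(** The intermediate value theorem, producing directly the merged list: the
    roots found are the entries of even rank of [a :: y]. *)
Lemma interlace p a s u : path (alternates (horner p)) a (rcons s u) ->
  exists y, [/\ path <%R a (rcons y u), odds (a :: y) = a :: s,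
    all (root p) (evens (a :: y)) & size (evens (a :: y)) = (size s).+1].
Proof.
elim: s a => [|b s IH] a /= /andP[/andP[ab gab]].
  move=> _; have [x /[!in_itv] /andP[ax xu] rx] := poly_ivtoo (ltW ab) gab.
  by exists [:: x]; split; rewrite //= ?andbT ?rx //; apply/andP; split.
move=> /IH[y [py oy ey sy]].
have [x /[!in_itv] /andP[ax xb] rx] := poly_ivtoo (ltW ab) gab.
exists [:: x, b & y]; move: oy ey sy => /= -> ey ->; rewrite rx ey py; split=> //.
by rewrite andbT; apply/andP; split.
Qed.

(** The differential equation of the Jacobi polynomial of degree [k] on the unit
    interval, for the weight [x^(b-1) (1-x)^(a-1)]. *)
Definition jacobi_eq a b (k : nat) p : Prop :=
  'X * (1 - 'X) * p^`()^`() + (b%:P - (a + b)%:P * 'X) * p^`()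
  + (k%:R * (k%:R + a + b - 1))%:P * p = 0.

Lemma jacobi_eq_deriv a b k p :
  jacobi_eq a b k.+1 p -> jacobi_eq (a + 1) (b + 1) k p^`().
Proof.
rewrite /jacobi_eq => /(congr1 (@deriv R)); rewrite !poly.derivE => <-.
rewrite -natr1; ring.
Qed.

Lemma path_rconsP s u v : path <%R u (rcons s v) =
  [&& u < v, sorted <%R s & all (fun x => u < x < v) s].
Proof.
rewrite path_sortedE; last exact: lt_trans.
rewrite (sorted_pairwise lt_trans) pairwise_rcons -(sorted_pairwise lt_trans).
rewrite all_rcons -andbA; case: ltP => //= _.
rewrite (all_predI (> u) (< v)).
by case: (all _ s); case: (all _ s); case: sorted.
Qed.

(** By induction [p^`()], which solves the equation for [a + 1] and [b + 1], has
    [k - 1] simple roots. At 0, at 1 and at these roots the equation reduces to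
    two terms, and says that [p] has there the sign of the derivative of
    [q = prodX (0 :: rcons s 1)], up to a global sign; hence [p] alternates on
    these [k + 1] points. *)
Lemma jacobi_roots k a b p : 0 < a -> 0 < b -> size p = k.+1 ->
  jacobi_eq a b k p ->
  exists s, [/\ size s = k, path <%R 0 (rcons s 1) & all (root p) s].
Proof.
elim: k a b p => [|k IH] a b p a0 b0 sp jp.
  by exists [::]; rewrite /= ltr01.
have sp' : size p^`() = k.+1 by rewrite size_deriv sp.
have [s [ss ps rs]] := IH _ _ _ (addr_gt0 a0 ltr01) (addr_gt0 b0 ltr01) sp'
  (jacobi_eq_deriv jp).
move: (ps); rewrite path_rconsP => /and3P[_ sos sin].
have us : uniq s by exact: lt_sorted_uniq.
have p'E : p^`() = lead_coef p^`() *: prodX s.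
  by apply: all_roots_prod_XsubC; rewrite ?sp' ?ss // uniq_rootsE.
set c := lead_coef _ in p'E.
have c0 : c != 0 by rewrite lead_coef_eq0 -size_poly_gt0 sp'.
pose K : R := k.+1%:R * (k.+1%:R + a + b - 1).
have K0 : 0 < K.
  rewrite mulr_gt0 ?ltr0Sn // -natr1; have : 0 <= k%:R :> R by [].
  by lra.
have ode x : K * p.[x] = - (x * (1 - x)) * (p^`()^`()).[x]
    - (b - (a + b) * x) * (p^`()).[x].
  move/(congr1 (horner^~ x)): jp; rewrite !hornerE -/K => h.
  by rewrite -[LHS]subr0 -h; ring.
have ut : uniq (0 :: rcons s 1).
  exact: (@lt_sorted_uniq _ _ (0 :: rcons s 1)).
have qE : prodX (0 :: rcons s 1) = 'X * ('X - 1) * prodX s.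
  by rewrite prodX_cons /prodX -cats1 big_cat big_seq1 /= polyC0 subr0; ring.
(* The values b, a, 1 of w come from the first order term of the equation at 0
   and at 1, and from the second order term at the roots of p^`(). *)
have [w w0 wE] : exists2 w : R -> R, (forall x, 0 < w x) &
    forall x, x \in 0 :: rcons s 1 ->
      K * p.[x] = w x * (c * (prodX (0 :: rcons s 1))^`().[x]).
  exists (fun x => if x == 0 then b else if x == 1 then a else 1) => [x|x].
    by case: eqP => // _; case: eqP.
  rewrite ode p'E qE !poly.derivE.
  rewrite !(hornerM, hornerD, hornerN, hornerX, hornerC, hornerZ).
  case: eqP => [-> _|x0]; first by ring.
  case: eqP => [-> _|x1]; first by ring.
  rewrite inE mem_rcons inE => /or3P[/eqP/x0|/eqP/x1|] //.
  by rewrite -root_prodX rootE => /eqP ->; ring.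
have : sorted (alternates (fun x => c * p.[x])) (0 :: rcons s 1).
  apply: alternates_deriv_prodX => // x xs.
  have := deriv_prodX_neq0 ut xs; set q := _.[x] => q0.
  rewrite -(pmulr_rgt0 _ K0) mulrA mulrCA wE // -/q.
  rewrite [X in 0 < X](_ : _ = w x * (c * q) ^+ 2); last by ring.
  by rewrite pmulr_rgt0 // exprn_even_gt0 //= mulf_neq0.
rewrite /= (@eq_path _ _ (alternates (horner p))) => [alt|x y]; last first.
  by rewrite /alternates mulrACA pmulr_rlt0 // -expr2 exprn_even_gt0.
have [y [py _ ry sy]] := interlace alt.
exists (evens (0 :: y)); rewrite sy ss ry; split=> //.
apply: subseq_path py; first exact: lt_trans.
by rewrite -!cats1 cat_subseq // (subseq_odds_evens y).1.
Qed.

End RealRoots.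

(** * Power sums of the roots *)

Section Newton.
Variable R : rcfType.
Implicit Types (s t : seq R) (p q : {poly R}).

Definition psum s (k : nat) : R := \sum_(a <- s) a ^+ k.

Lemma psum0 s : psum s 0 = (size s)%:R.
Proof. by rewrite /psum big_const_seq count_predT iter_addr_0. Qed.

(** The terms of nonnegative degree of ['X^N] times the expansion at infinity of
    the logarithmic derivative of [prodX s], which is the sum of the
    [psum s k / 'X^(k.+1)]. *)
Definition newton_poly (N : nat) s : {poly R} :=
  \sum_(k < N) psum s k *: 'X^(N.-1 - k).

Lemma coef_newton_poly N s i : (newton_poly N s)`_i =
  if (i < N)%N then psum s (N.-1 - i) else 0.
Proof.
rewrite /newton_poly coef_sum; case: ltnP => iN.
  have jN : (N.-1 - i < N)%N by lia.
  rewrite (bigD1 (Ordinal jN)) //= coefZ coefXn big1 ?addr0 => [|k /eqP kj].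
    by rewrite (_ : i == _) ?mulr1 //; apply/eqP; lia.
  rewrite coefZ coefXn (_ : i == _ = false) ?mulr0 //.
  apply/negbTE/eqP => ik; apply: kj; apply: val_inj => /=.
  by have := ltn_ord k; lia.
rewrite big1 // => k _; rewrite coefZ coefXn (_ : i == _ = false) ?mulr0 //.
by apply/negbTE/eqP; have := ltn_ord k; lia.
Qed.

Lemma newton_poly_cons N a s : newton_poly N (a :: s) =
  \sum_(k < N) 'X^(N.-1 - k) * a%:P ^+ k + newton_poly N s.
Proof.
rewrite /newton_poly -big_split /=; apply: eq_bigr => k _.
by rewrite /psum big_cons scalerDl -polyC_exp mulrC mul_polyC.
Qed.

Lemma size_mulS_leq p q i j : (size p <= i.+1)%N -> (size q <= j)%N ->
  (size (p * q)%R <= i + j)%N.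
Proof.
move=> sp sq; apply: leq_trans (size_polyMleq p q) _.
by rewrite -subn1 leq_subLR addnA add1n leq_add.
Qed.

(** Newton's identities at infinity: modulo terms of low degree, ['X^N] times the
    logarithmic derivative of [prodX s] is [newton_poly N s]. *)
Lemma size_deriv_prodX s N :
  (size ('X^N * (prodX s)^`() - prodX s * newton_poly N s)%R <= size s)%N.
Proof.
elim: s => [|a s IH].
  rewrite /prodX big_nil derivC mulr0 sub0r mul1r size_polyN.
  rewrite /newton_poly big1 ?size_poly0 // => k _.
  by rewrite /psum big_nil scale0r.
rewrite prodX_cons derivM derivXsubC mul1r newton_poly_cons.
set g := \sum_(k < N) _; set P := prodX s; set G := newton_poly _ _.
have gE : ('X - a%:P) * g = 'X^N - (a%:P) ^+ N by rewrite subrXX.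
rewrite (_ : _ - _ = (a ^+ N)%:P * P + ('X - a%:P) * ('X^N * P^`() - P * G)).
  apply: (leq_trans (size_polyD _ _)); rewrite geq_max; apply/andP; split.
    by apply: (@size_mulS_leq _ _ 0); rewrite ?size_polyC_leq1 ?size_prodX.
  by apply: (@size_mulS_leq _ _ 1); rewrite ?size_XsubC.
rewrite polyC_exp (_ : a%:P ^+ N = 'X^N - ('X - a%:P) * g); last first.
  by rewrite gE; ring.
by ring.
Qed.

Definition wronskian p q : {poly R} := p^`() * q - p * q^`().

Lemma size_wronskian_prodX s t N :
  (size ('X^N * wronskian (prodX s) (prodX t)
     - prodX s * prodX t * (newton_poly N s - newton_poly N t))%R
   <= size s + size t)%N.
Proof.
rewrite /wronskian.
set P := prodX s; set Q := prodX t; set G := newton_poly N s.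
set H := newton_poly N t.
rewrite (_ : _ - _ = ('X^N * P^`() - P * G) * Q + (- P) * ('X^N * Q^`() - Q * H));
  last by ring.
apply: (leq_trans (size_polyD _ _)); rewrite geq_max; apply/andP; split.
  by rewrite mulrC addnC size_mulS_leq ?size_prodX ?size_deriv_prodX.
by rewrite size_mulS_leq ?size_polyN ?size_prodX ?size_deriv_prodX.
Qed.

Lemma coefM_top p q i j : (size p <= i.+1)%N -> (size q <= j.+1)%N ->
  (p * q)`_(i + j) = p`_i * q`_j.
Proof.
move=> sp sq; rewrite coefM.
have ij : (i < (i + j).+1)%N by lia.
rewrite (bigD1 (Ordinal ij)) //= addKn big1 ?addr0 // => k /eqP ki.
have [kgt|kle] := ltnP i k; first by rewrite nth_default ?mul0r // (leq_trans sp).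
rewrite [q`_ _]nth_default ?mulr0 //; apply: leq_trans sq _.
have : (k : nat) <> i by move=> e; apply: ki; apply: val_inj.
by move=> ki'; move: (ltn_ord k); lia.
Qed.

Lemma coef_Xderiv p i : ('X * p^`())`_i = i%:R * p`_i.
Proof.
by rewrite coefXM coef_deriv; case: i => [|i]; rewrite ?mul0r ?mulr_natl.
Qed.

(** Let [P] and [Q] be the two products and [D = P - Q]. Equality of the power
    sums makes the Wronskian of [P] and [Q], which is that of [D] and [Q], of
    degree less than [n - 1]. But its coefficient of degree [deg D + n - 1] is
    [deg D - n] times the leading coefficient of [D], which is not 0 as both
    products are monic of degree [n]. *)
Lemma eq_psum_perm n s t : size s = n -> size t = n ->
  (forall k, (k <= n)%N -> psum s k = psum t k) -> perm_eq s t.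
Proof.
move=> ss st pst; apply: prod_XsubC_eq; apply/eqP; rewrite -subr_eq0.
rewrite -!/(prodX _); set P := prodX s; set Q := prodX t.
apply/negPn/negP => PQ.
have sP : size P = n.+1 by rewrite size_prodX ss.
have sQ : size Q = n.+1 by rewrite size_prodX st.
have Pn : P`_n = 1 by have /monicP := monic_prodX s; rewrite lead_coefE sP.
have Qn : Q`_n = 1 by have /monicP := monic_prodX t; rewrite lead_coefE sQ.
have := size_wronskian_prodX s t n.+1.
have -> : newton_poly n.+1 s = newton_poly n.+1 t.
  by apply: eq_bigr => k _; rewrite pst // -ltnS.
rewrite subrr mulr0 subr0 ss st -/P -/Q => sW.
pose D := P - Q; pose d := (size D).-1.
have sD : size D = d.+1 by rewrite prednK // size_poly_gt0.
have Dd : D`_d != 0 by rewrite -lead_coefE lead_coef_eq0.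
have dn : (d < n)%N.
  have : (size D <= n.+1)%N.
    by rewrite (leq_trans (size_polyD _ _)) // size_polyN sP sQ maxnn.
  rewrite sD ltnS leq_eqVlt => /orP[/eqP dn|//].
  by move: Dd; rewrite dn coefB Pn Qn subrr eqxx.
have : ('X^n * ('X * wronskian P Q))`_(n + (d + n)) = 0.
  rewrite mulrA -exprSr nth_default //; apply: leq_trans sW _.
  by rewrite leq_add2l leq_addl.
rewrite coefXnM ltnNge leq_addr /= addKn.
rewrite (_ : 'X * _ = ('X * D^`()) * Q - D * ('X * Q^`())); last first.
  by rewrite /wronskian /D derivB; ring.
have sX (p : {poly R}) i : size p = i.+1 -> (size ('X * p^`())%R <= i.+1)%N.
  move=> sp; apply: leq_trans (size_polyMleq _ _) _.
  by rewrite size_polyX size_deriv sp.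
rewrite coefB (coefM_top (sX D d sD)) ?sQ // (coefM_top _ (sX Q n sQ)) ?sD //.
rewrite !coef_Xderiv Qn !mulr1.
move/eqP; rewrite mulrC -mulrBr mulf_eq0 (negbTE Dd) subr_eq0 eqr_nat /=.
by rewrite ltn_eqF.
Qed.

(** Let [n = deg (A * B)] and let [H] be the difference of the two polynomials
    compared here. Multiplying the relation by ['X^n] and expanding the
    Wronskian at infinity shows that [A * B * H] has degree at most [n], so that
    [H] is a constant. *)
Lemma coef_wronskian_psum s t (u : {poly R}) (c : R) :
  let A := prodX s in let B := prodX t in
  (1 - 'X) * ('X * wronskian A B) = u * (A * B) + c%:P ->
  forall j, (0 < j)%N ->
  ((1 - 'X) * (newton_poly (size s + size t).+1 s
     - newton_poly (size s + size t).+1 t))`_j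
  = ('X^(size s + size t) * u)`_j.
Proof.
move=> A B; set n := (size s + size t)%N => AB j j0.
set G := newton_poly _ s - _.
have := size_wronskian_prodX s t n.+1; rewrite -/A -/B -/G -/n.
set E := _ - _ => sE.
pose H := (1 - 'X) * G - 'X^n * u.
have HE : A * B * H = c *: 'X^n - (1 - 'X) * E.
  have -> : c *: 'X^n = 'X^n * ((1 - 'X) * ('X * wronskian A B) - u * (A * B)).
    by rewrite AB addrAC subrr add0r mulrC mul_polyC.
  by rewrite /H /E exprSr; ring.
have mAB : A * B \is monic by rewrite monicMl ?monic_prodX.
have sAB : size (A * B)%R = n.+1.
  by rewrite size_monicM ?monic_prodX -?size_poly_eq0 ?size_prodX //= addnS.
have sH : (size H <= 1)%N.
  have [->|H0] := eqVneq H 0; first by rewrite size_poly0.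
  have : (size (A * B * H)%R <= n.+1)%N.
    rewrite HE; apply: (leq_trans (size_polyD _ _)); rewrite geq_max.
    rewrite (leq_trans (size_scale_leq _ _)) ?size_polyXn //= size_polyN.
    rewrite -add1n; apply: size_mulS_leq => //.
    by rewrite -size_polyN opprB -polyC1 size_XsubC.
  by rewrite size_monicM // sAB addSn /= -[n.+1]addn1 leq_add2l.
apply/eqP; rewrite -subr_eq0 -coefB -/H nth_default //.
exact: leq_trans sH j0.
Qed.

(** Multiplication by [1 - 'X] takes differences of consecutive coefficients, so
    that the previous lemma says that the differences of power sums have equal
    values for [k = 1..n]; the coefficients of degree [n.+1] and [n] determine
    [d] and this common value. *)
Lemma psum_of_wronskian s t (d tau c : R) :
  let A := prodX s in let B := prodX t in
  (1 - 'X) * ('X * wronskian A B)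
    = (d%:P * (1 - 'X) + tau%:P) * (A * B) + c%:P ->
  forall k, (0 < k <= size s + size t)%N -> psum s k - psum t k = - tau.
Proof.
move=> A B /coef_wronskian_psum; set n := (size s + size t)%N.
rewrite -/n => AB.
(* D j is the coefficient of degree j of the difference of Newton polynomials,
   hence the reversed numbering. *)
pose D j := psum s (n - j) - psum t (n - j).
have GE j : (newton_poly n.+1 s - newton_poly n.+1 t)`_j =
    if (j <= n)%N then D j else 0.
  by rewrite coefB !coef_newton_poly ltnS; case: ifP => // _; rewrite subrr.
have UE j : ('X^n * (d%:P * (1 - 'X) + tau%:P))`_j =
    if (j < n)%N then 0 else (d + tau) *+ (j == n) - d *+ (j == n.+1).
  rewrite coefXnM; case: ltnP => // nj.
  rewrite coefD coefCM coefB coef1 coefX coefC.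
  have -> : (j - n == 0)%N = (j == n) by lia.
  have -> : (j - n == 1)%N = (j == n.+1) by lia.
  by case: eqP => [->|?]; case: eqP => ?; rewrite ?mulr1n ?mulr0n; try lia; ring.
have step j : D j.+1 *+ (j.+1 <= n)%N - D j *+ (j <= n)%N =
    if (j.+1 < n)%N then 0 else (d + tau) *+ (j.+1 == n) - d *+ (j.+1 == n.+1).
  rewrite -UE -AB // mulrBl mul1r coefB coefXM !GE /=.
  by case: (j < n)%N; case: (j <= n)%N; rewrite ?mulr1n ?mulr0n.
have D0 : D n = d.
  have := step n; rewrite ltnn leqnn (leq_gtF (leqnSn n)) !eqxx.
  by rewrite (gtn_eqF (ltnSn n)) !mulr0n mulr1n !sub0r => /oppr_inj.
have Dj j : (j < n)%N -> D j = - tau.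
  elim: {j}(n - j.+1)%N {-2}j (erefl (n - j.+1)%N) => [|m IH] j jm jn.
    have nE : n = j.+1 by lia.
    have := step j; rewrite -nE D0 ltnn leqnn eqxx (ltnW jn).
    rewrite (ltn_eqF (ltnSn n)) !mulr1n mulr0n subr0 => h.
    by apply: oppr_inj; apply: (@addrI _ d); rewrite h opprK.
  have := step j; rewrite (_ : j.+1 < n)%N; last by lia.
  rewrite (_ : j.+1 <= n)%N ?(ltnW jn) ?mulr1n; last by lia.
  by move/eqP; rewrite subr_eq0 => /eqP <-; apply: IH; lia.
move=> k /andP[k0 kn]; rewrite -(Dj (n - k)%N); last by lia.
by rewrite /D subKn.
Qed.
End Newton.

(** * The explicit polynomials as Jacobi polynomials *)

Section Explicit.
Variable R : realType.
Implicit Types (a b t : R) (p q A B : {poly R}).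

(** Frobenius' method: the equation is a two-term recurrence between consecutive
    coefficients. *)
Lemma jacobi_eq_coef a b k p :
  (forall j, j.+1%:R * (j%:R + b) * p`_j.+1 =
     (j%:R * (j%:R + a + b - 1) - k%:R * (k%:R + a + b - 1)) * p`_j) ->
  jacobi_eq a b k p.
Proof.
move=> h; apply/polyP => j; rewrite coef0.
(* The Euler operator q |-> 'X * q^`() multiplies the coefficient of degree j by
   j; applied to p, to p^`() and to itself it expresses all the terms but
   b p^`(). *)
rewrite (_ : _ + _ = 'X * p^`()^`() + b%:P * p^`() - 'X * ('X * p^`())^`()
   - (a + b - 1)%:P * ('X * p^`()) + (k%:R * (k%:R + a + b - 1))%:P * p);
  last first.
  by rewrite !poly.derivE; ring.
rewrite !(coefD, coefN, coefCM, coef_Xderiv) coef_deriv.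
by have /eqP := h j; rewrite -subr_eq0 => /eqP hj; rewrite -[RHS]hj; ring.
Qed.

(** The common shape of the coefficients of [Ppoly], [Qpoly] and [Rpoly]: [k] is
    the degree, [M] is [2 * m] or [2 * m + 1], and [t] is the upper argument of
    the binomial coefficients. *)
Definition jacobi_coef (k M : nat) t (i : nat) : R :=
  (-1) ^+ i * ((k`! * (M - i)`!)%:R / (M`! * (k - i)`!)%:R) * gbinom t i.

Definition jacobi_poly (k M : nat) t : {poly R} :=
  \sum_(i < k.+1) jacobi_coef k M t i *: 'X^(k - i).

Lemma jacobi_polyE k M t :
  jacobi_poly k M t = \poly_(j < k.+1) jacobi_coef k M t (k - j).
Proof.
rewrite poly_def /jacobi_poly (reindex_inj rev_ord_inj) /=.
by apply: eq_bigr => i _; rewrite subSS subKn // -ltnS.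
Qed.

Lemma size_monic_jacobi_poly k M t :
  size (jacobi_poly k M t) = k.+1 /\ jacobi_poly k M t \is monic.
Proof.
have c0 : jacobi_coef k M t 0 = 1.
  rewrite /jacobi_coef /gbinom big_ord0 !subn0 fact0 expr0 !mul1r invr1 mulr1.
  by rewrite mulnC divff // pnatr_eq0 muln_eq0 negb_or -!lt0n !fact_gt0.
have sz : size (jacobi_poly k M t) = k.+1.
  by rewrite jacobi_polyE size_poly_eq // subnn c0 oner_eq0.
split=> //; rewrite monicE lead_coefE sz /= jacobi_polyE coef_poly ltnSn subnn.
by rewrite c0.
Qed.

Lemma jacobi_coefS k M t i : (i < k)%N -> (i < M)%N ->
  i.+1%:R * (M - i)%:R * jacobi_coef k M t i.+1 =
  - (k - i)%:R * (t - i%:R) * jacobi_coef k M t i.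
Proof.
move=> ik iM; rewrite /jacobi_coef /gbinom big_ord_recr /= factS exprS.
have -> : (k - i = (k - i.+1).+1)%N by lia.
have -> : (M - i = (M - i.+1).+1)%N by lia.
rewrite !factS !natrM.
have nz (n : nat) : n`!%:R != 0 :> R by rewrite pnatr_eq0 -lt0n fact_gt0.
move: (nz k) (nz M) (nz i) (nz (k - i.+1)%N) (nz (M - i.+1)%N).
have nzS (n : nat) : 1 + n%:R != 0 :> R by rewrite nat1r pnatr_eq0.
move: (nzS i) (nzS (k - i.+1)%N) (nzS (M - i.+1)%N) => *.
by field; do ?[apply/andP; split].
Qed.

Lemma jacobi_poly_eq a b k M t : (k <= M)%N -> t = k%:R - 1 + b ->
  M%:R = k%:R *+ 2 + a + b - 2 ->
  jacobi_eq a b k (jacobi_poly k M t).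
Proof.
move=> kM tE ME; apply: jacobi_eq_coef => j.
rewrite jacobi_polyE !coef_poly !ltnS; case: (ltngtP j k) => [jk|kj|->].
- have := @jacobi_coefS k M t (k - j.+1) ltac:(lia) ltac:(lia).
  have -> : ((k - j.+1).+1 = k - j)%N by lia.
  have -> : (k - (k - j.+1) = j.+1)%N by lia.
  rewrite !natrB ?ME ?tE; try lia.
  move/eqP; rewrite -subr_eq0 => /eqP h; apply: subr0_eq.
  by rewrite -[RHS]h; ring.
- by rewrite !mulr0.
- by rewrite subrr mul0r mulr0.
Qed.

End Explicit.

(** * Interlacing of the two families of roots *)

Section Wronskian.
Variable R : rcfType.
Implicit Types (tau : R) (A B : {poly R}).

(** The parameters of the two equations are such that the derivative of the
    difference of both sides is [B] times the first equation minus [A] times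
    the second one. *)
Lemma jacobi_wronskian (m d : nat) tau A B :
  jacobi_eq (1 + tau) (1 - d%:R - tau) (m + d) A ->
  jacobi_eq (1 - tau) (1 + d%:R + tau) m B ->
  exists c : R, (1 - 'X) * ('X * wronskian A B) =
    (d%:R%:P * (1 - 'X) + tau%:P) * (A * B) + c%:P.
Proof.
rewrite /jacobi_eq; set u := (X in X = 0); set v := (X in _ -> X = 0 -> _).
move=> u0 v0.
set L := (1 - 'X) * _; set U := _ * (A * B).
suff /size1_polyC E : (size (L - U)%R <= 1)%N.
  by exists (L - U)`_0; rewrite -E addrC subrK.
have : (L - U)^`() = u * B - A * v.
  by rewrite /L /U /u /v /wronskian !poly.derivE; ring.
rewrite u0 v0 mul0r mulr0 subrr => /(congr1 (fun p : {poly R} => size p)).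
by rewrite size_poly0 size_deriv; case: size => // -[].
Qed.

End Wronskian.

Section Nodes.
Variable R : rcfType.
Implicit Types (tau : R) (A B : {poly R}) (s x : seq R).

Lemma jacobi_prodX k (a b : R) (p : {poly R}) : 0 < a -> 0 < b -> size p = k.+1 ->
  p \is monic -> jacobi_eq a b k p ->
  exists s, [/\ size s = k, path <%R 0 (rcons s 1) & p = prodX s].
Proof.
move=> a0 b0 sp mp jp; have [s [ss ps rs]] := jacobi_roots a0 b0 sp jp.
exists s; split=> //; apply: monic_roots_prodX; rewrite ?ss //.
by move: ps; rewrite path_rconsP => /and3P[_ /lt_sorted_uniq].
Qed.

(** At a root [a] of [A], [jacobi_wronskian] becomes [(1 - a) a A'(a) B(a) = c],
    and at 1 it gives [c = - tau A(1) B(1)], of the sign of [- tau].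
    If [d] is true then [c > 0]: [B] has the sign of [A'] at the [m + 1] roots of
    [A], which leaves room for all its [m] roots between them. If [d] is false
    then [c < 0]: on the roots of [A], completed by 1, [B] has the sign of the
    derivative of [A * ('X - 1)], and its [m]-th root lies between the last
    root of [A] and 1. *)
Lemma interlacing_nodes (d : bool) (m : nat) tau A B :
  - d%:R < tau < 1 - d%:R ->
  size A = (m + d).+1 -> size B = m.+1 -> A \is monic -> B \is monic ->
  jacobi_eq (1 + tau) (1 - d%:R - tau) (m + d) A ->
  jacobi_eq (1 - tau) (1 + d%:R + tau) m B ->
  exists x, [/\ size x = (2 * m + d)%N, path <%R 0 (rcons x 1),
    A = prodX (odds x) & B = prodX (evens x)].
Proof.
move=> /andP[tau_gt tau_lt] szA szB mA mB jA jB.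
have d01 : 0 <= (d%:R : R) <= 1 by rewrite ler0n lern1 leq_b1.
have [s [ss ps AE]] : exists s,
    [/\ size s = (m + d)%N, path <%R 0 (rcons s 1) & A = prodX s].
  by apply: (jacobi_prodX _ _ szA mA jA); lra.
have [t [_ pt BE]] : exists t,
    [/\ size t = m, path <%R 0 (rcons t 1) & B = prodX t].
  by apply: (jacobi_prodX _ _ szB mB jB); lra.
have [c ABc] := jacobi_wronskian jA jB.
move: (ps) (pt); rewrite !path_rconsP => /and3P[_ sos sin] /and3P[_ _ tin].
have A1 : 0 < A.[1].
  by rewrite AE prodX_gt0 //; apply: sub_all sin => ? /andP[].
have B1 : 0 < B.[1].
  by rewrite BE prodX_gt0 //; apply: sub_all tin => ? /andP[].
have evalW z : (1 - z) * (z * (A^`().[z] * B.[z] - A.[z] * B^`().[z])) =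
    (d%:R * (1 - z) + tau) * (A.[z] * B.[z]) + c.
  move/(congr1 (horner^~ z)): ABc.
  by rewrite /wronskian -polyC1 !(hornerM, hornerD, hornerN, hornerX, hornerC).
have cE : c = - tau * (A.[1] * B.[1]).
  by apply/eqP; rewrite -subr_eq0; apply/eqP; have := evalW 1; lra.
have ABs a : a \in s -> (1 - a) * a * (A^`().[a] * B.[a]) = c.
  move=> sa; have := evalW a.
  have -> : A.[a] = 0 by apply/eqP; rewrite -rootE AE root_prodX.
  by rewrite !mul0r mulr0 subr0 add0r mulrA.
have Bx x : path <%R 0 (rcons x 1) -> all (root B) (evens x) ->
    size (evens x) = m -> B = prodX (evens x).
  rewrite path_rconsP => /and3P[_ sox _] rx sx.
  apply: monic_roots_prodX; rewrite ?sx //.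
  apply: subseq_uniq (subseq_odds_evens x).2 _; exact: lt_sorted_uniq.
have sx_of x : size (odds x) = (m + d)%N -> size (evens x) = m ->
    size x = (2 * m + d)%N.
  move=> so se; rewrite (perm_size (perm_odds_evens x)) size_cat so se.
  by rewrite addnAC addnn mul2n.
have tau_sgn : if d then tau < 0 else 0 < tau.
  by case: (d) tau_gt tau_lt; rewrite ?mulr1n ?mulr0n ?subrr ?oppr0 ?subr0.
case: d ss tau_sgn sx_of {szA jA jB ABc evalW tau_gt tau_lt d01} =>
  ss tau_sgn sx_of.
  rewrite addn1 in ss.
  have c0 : 0 < c by rewrite cE pmulr_lgt0 ?mulr_gt0 // oppr_gt0.
  have : sorted (alternates (horner B)) s.
    apply: alternates_deriv_prodX => // a sa; rewrite -AE mulrC.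
    move: c0; rewrite -(ABs a sa) pmulr_rgt0 //.
    by have /andP[? ?] := allP sin _ sa; rewrite mulr_gt0 ?subr_gt0.
  case: s ss ps AE {sos sin ABs} => // a s [ss] /= /andP[a0 ps] AE.
  case/lastP: s ss ps AE => [|s z] ss ps AE alt.
    have pa : path <%R 0 (rcons [:: a] 1) by rewrite /= a0.
    by exists [:: a]; split=> //; [rewrite -ss|exact: Bx].
  move: ss ps; rewrite size_rcons rcons_path last_rcons => ss /andP[_ z1].
  have [y [py oy ry sy]] := interlace alt.
  have soy : size (odds (a :: y)) = m by rewrite oy.
  have ev : odd (size (a :: y)) = false.
    rewrite (perm_size (perm_odds_evens _)) size_cat soy sy ss addnn.
    exact: odd_double.
  have [oE eE] := odds_evens_rcons (a :: y) z; rewrite ev oy in oE eE.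
  have px : path <%R 0 (rcons (a :: rcons y z) 1).
    by rewrite /= a0 rcons_path py last_rcons.
  exists (a :: rcons y z); rewrite -rcons_cons oE eE; split=> //.
  - by apply: sx_of; rewrite ?oE ?eE ?sy // size_rcons /= -ss addn1.
  - by rewrite -[evens _]eE; apply: Bx; rewrite // eE ?sy.
rewrite addn0 in ss.
have c0 : c < 0 by rewrite cE mulNr oppr_lt0 mulr_gt0 // mulr_gt0.
have [s0|s0] := eqVneq s [::].
  exists [::]; have m0 : m = 0%N by rewrite -ss s0.
  by rewrite m0 /= ltr01 AE s0; split=> //; apply: (Bx [::]); rewrite /= ?ltr01.
have alt : sorted (alternates (horner B)) (rcons s 1).
  have so1 : sorted <%R (rcons s 1) by exact: path_sorted ps.
  have EA (z : R) : (prodX (rcons s 1))^`().[z] = A.[z] + (z - 1) * A^`().[z].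
    rewrite /prodX -cats1 big_cat big_seq1 -/(prodX s) -AE derivM derivXsubC.
    by rewrite hornerD !hornerM hornerXsubC hornerC; ring.
  apply: alternates_deriv_prodX => // a; rewrite mem_rcons inE EA.
  case/orP => [/eqP ->|sa]; first by rewrite subrr mul0r addr0 mulr_gt0.
  have -> : A.[a] = 0 by apply/eqP; rewrite -rootE AE root_prodX.
  have /andP[a0 a1] := allP sin _ sa.
  rewrite add0r -(pmulr_rgt0 _ a0).
  by move: c0; rewrite -(ABs a sa) -oppr_gt0; congr (0 < _); ring.
case: s ss ps AE s0 alt {sos sin ABs} => // a s /= ss /andP[a0 ps] AE _ alt.
have [y [py oy ry sy]] := interlace alt.
have px : path <%R 0 (rcons (a :: y) 1) by rewrite /= a0.
exists (a :: y); rewrite oy; split=> //.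
- by apply: sx_of; rewrite ?oy ?sy ?addn0.
- exact: (Bx (a :: y) px ry (etrans sy ss)).
Qed.

End Nodes.

(** * Pairing a polynomial with a step function *)

Section Pairing.
Variable R : realType.
Implicit Types (P : {poly R}) (s : seq R) (a t : R).
Notation leb := (@lebesgue_measure R).

Lemma Rintegral_deriv_horner P (a b : R) : a <= b ->
  \int[leb]_(t in `[a, b]) (P^`()).[t] = P.[b] - P.[a].
Proof.
rewrite le_eqVlt => /predU1P[->|ab].
  by rewrite set_itv1 Rintegral_set1 subrr.
rewrite /Rintegral (@continuous_FTC2 _ _ (horner P)) ?EFinN //.
- exact/continuous_subspaceT/continuous_horner.
- split=> [x _||]; first exact: derivable_horner.
  + exact/cvg_at_right_filter/continuous_horner.
  + exact/cvg_at_left_filter/continuous_horner.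
- by move=> x _; rewrite derivE.
Qed.

Lemma integrable_horner P : leb.-integrable `[0, 1] (EFin \o horner P).
Proof.
apply: continuous_compact_integrable; first exact: segment_compact.
exact/continuous_subspaceT/continuous_horner.
Qed.

Lemma step_horner P a : (fun t => (a <= t)%R%:R * P.[t]) = horner P \_ `[a, +oo[.
Proof.
apply/funext => t; rewrite patchE mem_setE in_itv /= andbT.
by case: (a <= t); rewrite ?mul1r ?mul0r.
Qed.

Lemma integrable_step_horner P a :
  leb.-integrable `[0, 1] (EFin \o (fun t => (a <= t)%R%:R * P.[t])).
Proof.
rewrite step_horner -restrict_EFin; apply/integrable_restrict => //.
apply: integrableS (integrable_horner P) => //; exact: measurableI.
Qed.

Lemma Rintegral_step_horner P a : 0 <= a <= 1 ->
  \int[leb]_(t in `[0, 1]) ((a <= t)%R%:R * P^`().[t]) = P.[1] - P.[a].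
Proof.
move=> /andP[a0 a1]; rewrite step_horner -Rintegral_mkcondr.
rewrite -(Rintegral_deriv_horner P a1); congr (Rintegral _ _ _).
apply/seteqP; split=> t /=; rewrite !in_itv /=; lra.
Qed.

Definition steps s t : R := \sum_(a <- s) (a <= t)%R%:R.

Lemma steps_horner P s : all (fun a => 0 <= a <= 1) s ->
  leb.-integrable `[0, 1] (EFin \o (fun t => steps s t * P^`().[t])) /\
  \int[leb]_(t in `[0, 1]) (steps s t * P^`().[t]) =
    \sum_(a <- s) (P.[1] - P.[a]).
Proof.
elim: s => [_|a s IH] /=.
  have E : (fun t => steps [::] t * P^`().[t]) = (fun=> 0).
    by apply/funext => t; rewrite /steps big_nil mul0r.
  rewrite E big_nil Rintegral_cst // mul0r; split=> //.
  exact: integrable0.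
move=> /andP[a01 /IH[Is Es]].
have E : (fun t => steps (a :: s) t * P^`().[t]) =
    (fun t => (a <= t)%R%:R * P^`().[t] + steps s t * P^`().[t]).
  by apply/funext => t; rewrite /steps big_cons mulrDl.
have Ia := integrable_step_horner P^`() a.
rewrite E RintegralD // Rintegral_step_horner // Es big_cons; split=> //.
exact: (integrableD _ Ia Is).
Qed.

(** Summation by parts. *)
Lemma alternating_telescope (h : nat -> R) n :
  \sum_(m < n.+1) (-1) ^+ m * (h m - h m.+1) =
  h 0%N - (\sum_(j < n) (-1) ^+ j * h j.+1) *+ 2 - (-1) ^+ n * h n.+1.
Proof.
elim: n => [|n IH]; first by rewrite big_ord_recl !big_ord0 expr0; ring.
by rewrite big_ord_recr IH /= [in RHS]big_ord_recr /= exprS; ring.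
Qed.

Lemma Delta_node n (x : n.-tuple R) m : Delta x -> (m <= n)%N ->
  node x m <= node x m.+1.
Proof.
move=> Dx mn; apply: (sorted_leq_nth le_trans (@lexx _ R) 1 Dx) => //;
  by rewrite inE /= size_rcons size_tuple ltnS // leqW.
Qed.

Lemma Delta_all n (x : n.-tuple R) : Delta x -> all (fun a => 0 <= a <= 1) x.
Proof.
rewrite /Delta [X in X -> _]/mkset /= (path_sortedE le_trans).
rewrite (sorted_pairwise le_trans) pairwise_rcons all_rcons.
move=> /andP[/andP[_ x0] /andP[x1 _]].
by apply/allP => a ax; rewrite (allP x0) ?(allP x1).
Qed.

(** Each node flips the sign: odd ones from 1 to -1, even ones back to 1. *)
Lemma Sigma_fun_steps n (x : n.-tuple R) t : Delta x -> 0 <= t <= 1 ->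
  Sigma_fun x t = 1 - (steps (odds x) t - steps (evens x) t) *+ 2.
Proof.
move=> Dx /andP[t0 t1].
pose h m : R := (node x m <= t)%R%:R.
have hn : h n.+1 = \1_([set 1] : set R) t.
  rewrite /h /node /= nth_rcons size_tuple ltnn eqxx indicE.
  have -> : (t \in [set 1 : R]) = (t == 1) by apply/idP/eqP; rewrite inE.
  by rewrite eq_le t1.
have h0 : h 0%N = 1 by rewrite /h /node /= t0.
rewrite /Sigma_fun -hn.
under eq_bigr => m _.
  rewrite (_ : \1_ _ t = h m - h m.+1); last first.
    rewrite indicE mem_setE in_itv /= /h ltNge.
    have /(_ (node x m) (node x m.+1)) : forall a b : R, a <= b ->
      ((a <= t)%R && ~~ (b <= t)%R)%:R = (a <= t)%R%:R - (b <= t)%R%:R :> R.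
      move=> a b ab; case: (leP b t) => bt; last by rewrite andbT subr0.
      by rewrite (le_trans ab bt) subrr.
    by apply; apply: Delta_node => //; rewrite -ltnS.
  over.
rewrite (alternating_telescope h) subrK h0; congr (_ - _ *+ 2).
rewrite /steps (sum_odds_evens 1) size_tuple; apply: eq_bigr => j _.
by rewrite /h /node /= nth_rcons size_tuple ltn_ord.
Qed.

Lemma mu01_ae_eq (f g : R -> R) : f = g %[ae mu01 R] ->
  {ae leb, forall t, `[0, 1]%classic t -> f t = g t}.
Proof.
move=> [N [mN N0 fgN]]; exists (N `&` `[0, 1]); split=> //.
  exact: measurableI.
move=> t /= /not_implyP[t01 fgt]; split=> //; apply: fgN => /= h.
by apply: fgt; apply: h.
Qed.

Lemma ae_eq_mu01 (f g : R -> R) : {in `[0, 1], f =1 g} -> f = g %[ae mu01 R].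
Proof.
move=> fg; exists (~` `[0, 1]); split.
- exact: measurableC.
- by rewrite /mu01 /= /mrestr setICl measure0.
- move=> t /= /not_implyP[_ fgt] t01; apply: fgt; exact: fg.
Qed.

(** The fundamental theorem of calculus on each piece, with the contributions of
    [P.[1]] collected: the number of odd nodes minus that of even nodes is
    the parity of [n]. *)
Lemma pairing_Sigma n (x : n.-tuple R) (lambda : R) P : Delta x -> P.[0] = 0 ->
  pairing (fun t => (P^`()).[t]) (fun t => Sigma x t - lambda) =
  ((-1) ^+ n - lambda) * P.[1] +
    (\sum_(a <- odds x) P.[a] - \sum_(a <- evens x) P.[a]) *+ 2.
Proof.
move=> Dx P0; rewrite /pairing.
have xall := Delta_all Dx.
have [oin ein] : all (fun a => 0 <= a <= 1) (odds x) /\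
                 all (fun a => 0 <= a <= 1) (evens x).
  by split; apply/allP => a ax; apply: (allP xall);
    apply: mem_subseq ax; have [] := subseq_odds_evens x.
have [oI oE] := steps_horner P oin.
have [eI eE] := steps_horner P ein.
pose F t := (1 - lambda) * P^`().[t] - 2 * (steps (odds x) t * P^`().[t])
  + 2 * (steps (evens x) t * P^`().[t]).
have pI := integrable_horner P^`().
have zI (c : R) (f : R -> R) : leb.-integrable `[0, 1] (EFin \o f) ->
    leb.-integrable `[0, 1] (EFin \o (fun t => c * f t)).
  by move=> fI; exact: (integrableZl _ c fI).
have bI : leb.-integrable `[0, 1] (EFin \o
    (fun t => (1 - lambda) * P^`().[t] - 2 * (steps (odds x) t * P^`().[t]))).
  exact: (integrableB _ (zI _ _ pI) (zI _ _ oI)).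
have FI : leb.-integrable `[0, 1] (EFin \o F).
  exact: (integrableD _ bI (zI 2 _ eI)).
transitivity (\int[leb]_(t in `[0, 1]) F t).
  congr fine; apply: ae_eq_integral => //.
  - apply/measurable_EFinP; apply: measurable_funM.
      apply: measurable_funB; last exact: measurable_cst.
      apply: measurable_funTS.
      exact: (@measurable_funPT _ _ _ _ (repr (Sigma_class x))).
    by apply/measurable_EFinP; exact: measurable_int pI.
  - exact: measurable_int FI.
  - have /mu01_ae_eq := SigmaE x.
    move=> [N [mN N0 sN]]; exists N; split=> // t /= nt.
    apply: sN => /= h; apply: nt => t01; rewrite h // Sigma_fun_steps //.
    by congr (_%:E); rewrite /F; ring.
rewrite /F (RintegralD _ bI (zI _ _ eI)) //.
rewrite (RintegralB _ (zI _ _ pI) (zI _ _ oI)) //.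
rewrite !RintegralZl // oE eE Rintegral_deriv_horner // P0 subr0.
have sumE s : \sum_(a <- s) (P.[1] - P.[a]) =
    (size s)%:R * P.[1] - \sum_(a <- s) P.[a].
  by rewrite big_split /= sumrN big_const_seq count_predT iter_addr_0 mulr_natl.
have nE : (-1) ^+ n = 1 + 2 * ((size (evens x))%:R - (size (odds x))%:R) :> R.
  rewrite !size_odds_evens size_tuple uphalf_half natrD -signr_odd.
  by case: (odd n) => /=; rewrite ?expr1 ?expr0 ?mulr1n ?mulr0n; ring.
by rewrite !sumE nE; ring.
Qed.

End Pairing.

(** * The moment conditions *)

Section Moments.
Variable R : realType.
Implicit Types (lambda : R) (p : {poly R}).

Lemma exists_antiderivative n p : (size p <= n)%N ->
  exists P : {poly R}, [/\ P^`() = p, P`_0 = 0 & (size P <= n.+1)%N].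
Proof.
move=> sp.
(* For i = 0 this is a division by 0, hence the coefficient is 0. *)
exists (\poly_(i < n.+1) (p`_i.-1 / i%:R)).
split; [|by rewrite coef_poly invr0 mulr0|exact: size_poly].
apply/polyP => i; rewrite coef_deriv coef_poly ltnS /=.
case: ltnP => [_|ni]; last by rewrite mul0rn nth_default // (leq_trans sp).
by rewrite -[X in X = _]mulr_natr divfK // pnatr_eq0.
Qed.

Lemma orthogonal_Sigma n (x : n.-tuple R) lambda : Delta x ->
  (forall p, (size p <= n)%N ->
     pairing (fun t => p.[t]) (fun t => Sigma x t - lambda) = 0) <->
  (forall k, (0 < k <= n)%N ->
     psum (odds x) k - psum (evens x) k = - (((-1) ^+ n - lambda) / 2)).
Proof.
move=> Dx; split=> [orth k /andP[k0 kn]|mom p sp].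
  have sumX s : \sum_(a <- s) ('X^k).[a] = psum s k.
    by apply: eq_bigr => a _; rewrite hornerXn.
  have := pairing_Sigma lambda Dx (_ : ('X^k : {poly R}).[0] = 0).
  rewrite orth; last by rewrite size_deriv size_polyXn.
  rewrite !sumX !hornerXn expr0n expr1n eqn0Ngt k0 /= => /(_ erefl).
  by rewrite mulr1; lra.
have [P [<- P0 sP]] := exists_antiderivative sp.
rewrite pairing_Sigma ?horner_coef0 //.
have sumP s : \sum_(a <- s) P.[a] = \sum_(i < n.+1) P`_i * psum s i.
  under eq_bigr => a _ do rewrite (horner_coef_wide a sP).
  by rewrite exchange_big; apply: eq_bigr => i _; rewrite /psum mulr_sumr.
rewrite !sumP -sumrB.
under eq_bigr => i _ do rewrite -mulrBr.
rewrite big_ord_recl P0 mul0r add0r (horner_coef_wide _ sP) big_ord_recl P0.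
rewrite mul0r add0r -sumrMnl mulr_sumr -big_split big1 //= => i _.
by rewrite mom ?ltn_ord // expr1n mulr1; field.
Qed.

Lemma eq_psum_Sigma n (x y : n.-tuple R) : Delta x -> Delta y ->
  (forall k, (0 < k <= n)%N ->
     psum (odds x) k - psum (evens x) k = psum (odds y) k - psum (evens y) k) ->
  Sigma x = Sigma y.
Proof.
move=> Dx Dy mom.
have szE (u v : n.-tuple R) : size (odds u ++ evens v) = n.
  rewrite size_cat !size_odds_evens !size_tuple uphalf_half -addnA addnn.
  exact: odd_double_half.
have perm : perm_eq (odds x ++ evens y) (odds y ++ evens x).
  apply: (eq_psum_perm (szE _ _) (szE _ _)) => -[_|k kn].
    by rewrite !psum0 !szE.
  by have := mom k.+1 kn; rewrite /psum !big_cat /=; lra.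
have steps_perm t : steps (odds x) t - steps (evens x) t =
    steps (odds y) t - steps (evens y) t.
  have : steps (odds x ++ evens y) t = steps (odds y ++ evens x) t.
    exact: perm_big.
  by rewrite /steps !big_cat /=; lra.
apply: eq_Linfty; apply: ae_eq_trans (SigmaE x) _.
apply: ae_eq_trans _ (ae_eq_sym (SigmaE y)).
apply: ae_eq_mu01 => t t01.
by rewrite !Sigma_fun_steps ?steps_perm // -in_itv.
Qed.

Lemma PpolyE m (theta : R) :
  Ppoly m theta = jacobi_poly m (2 * m) (m%:R + theta).
Proof. by []. Qed.

Lemma QpolyE m (theta : R) :
  Qpoly m theta = jacobi_poly (m + 1) (2 * m + 1) (m%:R + theta).
Proof. by rewrite /Qpoly /jacobi_poly /jacobi_coef (addn1 m). Qed.

Lemma RpolyE m (theta : R) :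
  Rpoly m theta = jacobi_poly m (2 * m + 1) (m%:R + 1 + theta).
Proof. by []. Qed.

Lemma lists_roots_prodX (x : seq R) p q : sorted <%R x ->
  p = prodX (odds x) -> q = prodX (evens x) ->
  lists_roots x p q /\ lists_roots x q p.
Proof.
move=> sx -> ->; split; split=> // a; rewrite !root_prodX;
  rewrite (perm_mem (perm_odds_evens x)) mem_cat //; exact: orbC.
Qed.

(** Both parities at once: for [n = 2 m] the two polynomials are
    [Ppoly m (- tau)] and [Ppoly m tau]; for [n = 2 m + 1] they are
    [Qpoly m (- tau)] and [Rpoly m tau]. *)
Lemma exists_nodes n lambda : -1 < lambda < 1 ->
  let m := n./2 in let d := odd n in
  let tau := ((-1) ^+ n - lambda) / 2 in
  exists x : n.-tuple R,
    [/\ path <%R 0 (rcons x 1),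
      jacobi_poly (m + d) (2 * m + d) (m%:R - tau) = prodX (odds x),
      jacobi_poly m (2 * m + d) (m%:R + d%:R + tau) = prodX (evens x) &
      forall k, (0 < k <= n)%N -> psum (odds x) k - psum (evens x) k = - tau].
Proof.
move=> /andP[l1 l2] m d tau.
set A := jacobi_poly (m + d) _ _; set B := jacobi_poly m _ _.
have [szA mA] := size_monic_jacobi_poly (m + d) (2 * m + d) (m%:R - tau).
have [szB mB] := size_monic_jacobi_poly m (2 * m + d) (m%:R + d%:R + tau).
have jA : jacobi_eq (1 + tau) (1 - d%:R - tau) (m + d) A.
  apply: jacobi_poly_eq; [lia|rewrite natrD; ring|].
  by rewrite natrD natrM; ring.
have jB : jacobi_eq (1 - tau) (1 + d%:R + tau) m B.
  apply: jacobi_poly_eq; [lia|ring|].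
  by rewrite natrD natrM; ring.
have tauE : - d%:R < tau < 1 - d%:R.
  by rewrite /tau -signr_odd -/d; case: (d) => /=; rewrite ?expr1 ?expr0; lra.
have [x [sx px AE BE]] := interlacing_nodes tauE szA szB mA mB jA jB.
have sxn : size x == n.
  by rewrite sx mul2n addnC odd_double_half.
exists (Tuple sxn); split=> // k kn.
have [c] := jacobi_wronskian jA jB.
rewrite [A]AE [B]BE => /psum_of_wronskian; apply.
by rewrite -size_cat -(perm_size (perm_odds_evens x)) (eqP sxn).
Qed.

End Moments.

Unset Implicit Arguments.

Theorem theorem4p7 (R : realType) (lambda : R) (n : nat) :
  -1 < lambda < 1 -> (1 <= n)%N ->
  exists sigma : Linfty R,
    unique (fun s : Linfty R => D R n s /\
      forall p : {poly R}, (size p <= n)%N ->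
        pairing (fun t => p.[t]) (fun t => s t - lambda) = 0) sigma /\
    exists x : n.-tuple R,
      [/\ Delta x,
          forall m : nat, n = (2 * m)%N ->
            lists_roots x (Ppoly m ((1 - lambda) / 2))
                          (Ppoly m (- ((1 - lambda) / 2))),
          forall m : nat, n = (2 * m + 1)%N ->
            lists_roots x (Qpoly m ((1 + lambda) / 2))
                          (Rpoly m (- ((1 + lambda) / 2))) &
          sigma = Sigma x].
Proof.
move=> lambda1 _.
have [x [px AE BE mom]] := exists_nodes n lambda1.
have Dx : Delta x.
  have : sorted <%R (0 :: rcons x 1) by [].
  rewrite /Delta /mkset.
  by apply: sub_sorted => a b; exact: ltW.
have sx : sorted <%R x by move: px; rewrite path_rconsP => /and3P[].
have [rootsAB rootsBA] := lists_roots_prodX sx AE BE.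
exists (Sigma x); split; last first.
  exists x; split=> // m nE.
  - have od : odd n = false by rewrite nE mul2n odd_double.
    have hf : n./2 = m by rewrite nE mul2n doubleK.
    move: rootsBA; rewrite -signr_odd od hf !addn0 addr0 expr0 !PpolyE.
    by [].
  - have od : odd n by rewrite nE addn1 /= mul2n odd_double.
    have hf : n./2 = m by rewrite nE mul2n addnC (half_bit_double _ true).
    move: rootsAB; rewrite -signr_odd od hf expr1 QpolyE RpolyE.
    have -> : m%:R - (-1 - lambda) / 2 = m%:R + (1 + lambda) / 2 by ring.
    by have -> : (-1 - lambda) / 2 = - ((1 + lambda) / 2) by ring.
split; first by split; [exists x|apply/orthogonal_Sigma].
move=> _ [[y Dy <-] /orthogonal_Sigma orthy].
apply: eq_psum_Sigma => // k kn.
by rewrite mom // orthy.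
Qed.
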